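(* Let $d$ be an odd prime, $n\ge 1$, and let $\sigma$ be a state on $\mathcal H=(\mathbb C^d)^{\otimes n}$ with exact stabilizer skeleton $S_\sigma$ (an isotropic subspace of $V^n$), $r=\dim S_\sigma$, and mean state $M(\sigma)$. Let $$S_\sigma=N_r\subset N_{r+1}\subset\cdots\subset N_n=\mathcal M$$ be a flag of isotropic subspaces of $V^n$ with $\dim N_k=k$ for $r\le k\le n$, and set $\rho_k=\Delta_{N_k}(\sigma)$. Then $$S(\sigma)=S(\rho_r)\le S(\rho_{r+1})\le\cdots\le S(\rho_n)\le S(M(\sigma)).$$ For every $r\le k<n$, $$D(\rho_k\|\rho_{k+1})=S(\rho_{k+1})-S(\rho_k),$$ $$D(\rho_k\|M(\sigma))=D(\rho_k\|\rho_{k+1})+D(\rho_{k+1}\|M(\sigma)).$$ Thus $$D(\sigma\|M(\sigma))=\sum_{k=r}^{n-1}D(\rho_k\|\rho_{k+1})+D(\rho_n\|M(\sigma)).$$ Moreover, each step obeys $0\le S(\rho_{k+1})-S(\rho_k)\le\log d$ for every $r\le k<n$.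
   Context: All logarithms are base two. $S(\rho)=-\operatorname{tr}\rho\log\rho$ is the von Neumann entropy and $D(\rho\|\omega)=\operatorname{tr}\rho(\log\rho-\log\omega)$ (for $\operatorname{supp}\rho\subseteq\operatorname{supp}\omega$) is the quantum relative entropy. Weyl operators. $d$ is an odd prime, $\omega_d=e^{2\pi i/d}$. On one qudit $X|k\rangle=|k+1\rangle$, $Z|k\rangle=\omega_d^k|k\rangle$ (arithmetic mod $d$). $V^n=\mathbb Z_d^n\times\mathbb Z_d^n$; for $p,q\in\mathbb Z_d^n$, $Z^p=\bigotimes_i Z^{p_i}$, $X^q=\bigotimes_i X^{q_i}$, and $w(p,q)=\omega_d^{-2^{-1}p\cdot q}Z^pX^q$ on $(\mathbb C^d)^{\otimes n}$, where $2^{-1}$ is the inverse of $2$ in $\mathbb Z_d$. Symplectic form: $\langle(p,q),(p',q')\rangle_s=p\cdot q'-p'\cdot q$. Characteristic function of a state $\rho$: $\Xi_\rho(z)=\operatorname{tr}[\rho\,w(-z)]$, so $\rho=d^{-n}\sum_{z\in V^n}\Xi_\rho(z)w(z)$. A linear subspace $N\subseteq V^n$ is isotropic if $\langle u,v\rangle_s=0$ for all $u,v\in N$; it is maximal isotropic iff moreover $\dim N=n$. For isotropic $N$ of dimension $k$, the stabilizer pinching is $\Delta_N(\rho)=d^{-k}\sum_{u\in N}w(u)\rho w(u)^\dagger$ (equivalently $\sum_{\nu\in\widehat N}P^{(N)}_\nu\rho P^{(N)}_\nu$ with $P^{(N)}_\nu=d^{-k}\sum_{u\in N}\nu(u)w(u)$,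 $\widehat N=\operatorname{Hom}(N,U(1))$). The exact stabilizer skeleton of a state $\rho$ is $S_\rho=\{z\in V^n:|\Xi_\rho(z)|=1\}$; it is an isotropic linear subspace. The mean state $M(\rho)$ is the state with $\Xi_{M(\rho)}(z)=\Xi_\rho(z)$ if $z\in S_\rho$ and $\Xi_{M(\rho)}(z)=0$ otherwise. *)

(* Defs.v *)
From HB Require Import structures.
From mathcomp Require Import all_boot all_order all_algebra.
From mathcomp Require Import spectral sesquilinear.
From mathcomp Require Import complex.
From mathcomp Require Import all_classical all_reals all_analysis.

Set Implicit Arguments.
Unset Strict Implicit.
Unset Printing Implicit Defensive.

Import Order.TTheory GRing.Theory Num.Theory.

Local Open Scope ring_scope.
Local Open Scope complex_scope.
Local Open Scope sesquilinear_scope.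

(* The size for which ['I_(qdim d)] is convertible to ['F_d]; it equals [d] when
   [d] is prime. *)
Notation qdim d := (Zp_trunc (pdiv d)).+2 (only parsing).

(* Labels of the computational basis |k_1, ..., k_n> of (C^d)^{(x) n}. *)
Notation basis_label d n := {ffun 'I_n -> 'F_d} (only parsing).

(* Operators on (C^d)^{(x) n}: matrices whose i-th row and column belong to the
   basis vector labelled [enum_val i]; their size is d ^ n. *)
Notation operator R d n := 'M[R[i]]_#|{: basis_label d n}| (only parsing).

Notation phase_vect d n := ('rV['F_d]_n * 'rV['F_d]_n)%type (only parsing).

Section WeylOperators.
Context {R : realType} {d n : nat}.
Local Notation C := R[i].
Local Notation Op := (operator R d n).
Local Notation V := (phase_vect d n).

Definition omega : C := cos (2 * pi / d%:R) +i* sin (2 * pi / d%:R).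

Definition shift_mx : 'M[C]_(qdim d) :=
  \matrix_(i, j) ((i : 'F_d) == (j : 'F_d) + 1)%:R.

Definition clock_mx : 'M[C]_(qdim d) :=
  \matrix_(i, j) ((i == j)%:R * omega ^+ j).

Definition tensor (A : 'I_n -> 'M[C]_(qdim d)) : Op :=
  \matrix_(i, j) \prod_(m < n)
    A m ((enum_val i : basis_label d n) m) ((enum_val j : basis_label d n) m).

(* Exponents in 'F_d are coerced to their representatives in 0, ..., d - 1. *)
Definition clock (p : 'rV['F_d]_n) : Op := tensor (fun m => clock_mx ^+ p 0 m).
Definition shift (q : 'rV['F_d]_n) : Op := tensor (fun m => shift_mx ^+ q 0 m).

Definition dotv (p q : 'rV['F_d]_n) : 'F_d := \sum_(i < n) p 0 i * q 0 i.

Definition weyl (z : V) : Op :=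
  omega ^+ (- (2%:R^-1 * dotv z.1 z.2) : 'F_d) *: (clock z.1 *m shift z.2).

Definition sympl (u v : V) : 'F_d := dotv u.1 v.2 - dotv v.1 u.2.

Definition isotropic (N : {vspace V}) : Prop :=
  {in N &, forall u v, sympl u v = 0}.

Definition char_fun (rho : Op) (z : V) : C := \tr (rho *m weyl (- z)).

Definition skeleton (rho : Op) : {set V} := [set z | `|char_fun rho z| == 1].

(* The operator whose characteristic function is that of [rho] on the skeleton
   and 0 elsewhere, given by Fourier inversion; see [char_fun_mean_state]. *)
Definition mean_state (rho : Op) : Op :=
  d%:R ^- n *: \sum_(z in skeleton rho) char_fun rho z *: weyl z.

Definition pinching (N : {vspace V}) (rho : Op) : Op :=
  d%:R ^- \dim N *: \sum_(u in N) weyl u *m rho *m (weyl u)^t*.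

End WeylOperators.

Section WeylOrthogonality.
Context {R : realType} {d n : nat}.
Hypotheses (d_prime : prime d) (d_odd : odd d).
Local Notation C := R[i].
Local Notation w := (@omega R d).
Local Notation V := (phase_vect d n).
Local Notation B := (basis_label d n).

Let d_gt2 : (2 < d)%N.
Proof. exact: odd_prime_gt2. Qed.

Let d_gt0 : 0 < d%:R :> R.
Proof. by rewrite ltr0n (leq_trans _ d_gt2). Qed.

Lemma omega_exp k :
  w ^+ k = cos (2 * pi / d%:R *+ k) +i* sin (2 * pi / d%:R *+ k).
Proof.
rewrite /omega; set t := 2 * pi / _.
elim: k => [|k IHk]; first by rewrite expr0 !mulr0n cos0 sin0.
rewrite exprSr IHk !mulrSr cosD sinD; apply/eqP.
by rewrite eq_complex /= eqxx [X in X == _]addrC eqxx.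
Qed.

Lemma omega_expd : w ^+ d = 1.
Proof.
rewrite omega_exp -mulr_natr divfK ?gt_eqF//.
by rewrite mulr_natl cos2pi sin2pi.
Qed.

Lemma omega_neq1 : w != 1.
Proof.
rewrite /omega eq_complex /= negb_and; apply/orP; right.
rewrite gt_eqF// sin_gt0_pi// !divr_gt0 ?mulr_gt0 ?pi_gt0//=.
by rewrite ltr_pdivrMr// mulrC ltr_pM2l ?pi_gt0// ltr_nat.
Qed.

Let chi (x : 'F_d) : C := w ^+ x.

Let omega_mod k : w ^+ (k %% qdim d) = w ^+ k.
Proof. by rewrite Fp_cast// expr_mod// omega_expd. Qed.

Let chiD x y : chi (x + y) = chi x * chi y.
Proof. by rewrite /chi -exprD -[RHS]omega_mod. Qed.

Let chiM x y : chi (x * y) = w ^+ (x * y).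
Proof. by rewrite /chi -[RHS]omega_mod. Qed.

Let chi0 : chi 0 = 1.
Proof. by []. Qed.

Let chi_neq1 x : x != 0 -> chi x != 1.
Proof.
move=> x0; apply: contra omega_neq1 => /eqP chix1.
have /eqP : chi (x * x^-1) = 1 by rewrite chiM exprM -/(chi x) chix1 expr1n.
by rewrite divff// /chi /= ; rewrite expr1.
Qed.

Let sum_chi a : \sum_(x : 'F_d) chi (x * a) = (a == 0)%:R * d%:R.
Proof.
have [->|a0] := eqVneq a 0.
  under eq_bigr do rewrite mulr0 chi0.
  by rewrite sumr_const card_Fp// mul1r.
rewrite mul0r; set S := (X in X = 0).
have : chi a * S = S.
  rewrite /S mulr_sumr [RHS](reindex_inj (addIr 1)) /=.
  by apply: eq_bigr => x _; rewrite mulrDl mul1r addrC chiD.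
move/eqP; rewrite -subr_eq0 -[X in _ - X]mul1r -mulrBl mulf_eq0 subr_eq0.
by rewrite (negPf (chi_neq1 a0)) => /eqP.
Qed.

Let clockX (a : 'F_d) i j :
  (@clock_mx R d ^+ a) i j = (i == j)%:R * chi ((j : 'F_d) * a).
Proof.
rewrite chiM; elim: (nat_of_ord a) i j => [|k IHk] i j.
  by rewrite expr0 muln0 expr0 mulr1 mxE.
rewrite exprS mxE (bigD1 i)//= big1 => [|l li]; rewrite IHk mxE; last first.
  by rewrite eq_sym (negPf li) !mul0r.
rewrite eqxx mul1r addr0 mulnS exprD.
by case: eqVneq => [->|]; rewrite ?mul1r// !mul0r mulr0.
Qed.

Let shiftX (b : 'F_d) i j :
  (@shift_mx R d ^+ b) i j = ((i : 'F_d) == (j : 'F_d) + b)%:R.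
Proof.
rewrite -{2}[b]natr_Zp; elim: (nat_of_ord b) i j => [|k IHk] i j.
  by rewrite expr0 addr0 mxE.
rewrite exprSr mxE (bigD1 ((j : 'F_d) + 1))//= big1 => [|l li].
  by rewrite IHk mxE eqxx mulr1 addr0 -addrA -natr1 [1 + _]addrC.
by rewrite !mxE (negPf li) mulr0.
Qed.

Let tensor_mul (A A' : 'I_n -> 'M[C]_(qdim d)) :
  tensor A *m tensor A' = tensor (fun m => A m *m A' m).
Proof.
apply/matrixP => i j; rewrite !mxE.
under eq_bigr do rewrite !mxE -big_split /=.
under [RHS]eq_bigr do rewrite mxE.
rewrite bigA_distr_bigA /= [RHS](reindex (@enum_val B predT)) /=.
  by apply: eq_bigr.
by apply: onW_bij; apply: enum_val_bij.
Qed.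

Let tr_tensor (A : 'I_n -> 'M[C]_(qdim d)) : \tr (tensor A) = \prod_m \tr (A m).
Proof.
rewrite bigA_distr_bigA /= [RHS](reindex (@enum_val B predT)) /=.
  by apply: eq_bigr => i _; rewrite mxE.
by apply: onW_bij; apply: enum_val_bij.
Qed.

Let tr1 (a b a' b' : 'F_d) :
  \tr ((@clock_mx R d ^+ a *m shift_mx ^+ b)
    *m (clock_mx ^+ a' *m shift_mx ^+ b'))
  = (b + b' == 0)%:R * ((a + a' == 0)%:R * d%:R * chi (b * a)).
Proof.
have E (c e : 'F_d) i j : (@clock_mx R d ^+ c *m shift_mx ^+ e) i j =
    ((i : 'F_d) == (j : 'F_d) + e)%:R * chi ((i : 'F_d) * c).
  rewrite mxE (bigD1 i)//= big1 => [|l li].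
    by rewrite clockX shiftX eqxx mul1r addr0 mulrC.
  by rewrite clockX eq_sym (negPf li) !mul0r.
transitivity (\sum_(j : 'F_d)
    (b + b' == 0)%:R * (chi (j * (a + a')) * chi (b * a))); last first.
  by rewrite -mulr_sumr -mulr_suml sum_chi.
rewrite mxtrace_mulC; apply: eq_bigr => j _; rewrite mxE.
rewrite (bigD1 ((j : 'F_d) + b))//= big1 => [|l li]; last first.
  by rewrite !E (negPf li) mul0r mulr0.
rewrite !E eqxx mul1r addr0 -addrA -[X in X == _]addr0 (inj_eq (addrI _)).
rewrite eq_sym -mulrA -!chiD; congr (_ * chi _).
by rewrite mulrDl mulrDr addrA [j * a + _]addrC.
Qed.

Lemma tr_weyl_mul (z z' : V) :
  \tr (weyl z *m weyl (- z')) = (z == z')%:R * d%:R ^+ n :> C.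
Proof.
rewrite /weyl /clock /shift !tensor_mul -scalemxAl -scalemxAr scalerA mxtraceZ.
rewrite tensor_mul tr_tensor -/(chi _) -/(chi _) -chiD.
under eq_bigr do rewrite tr1 !mxE !subr_eq0.
have [<-|zz'] := eqVneq z z'.
  under eq_bigr do rewrite !eqxx !mul1r.
  rewrite big_split /= prodr_const card_ord mul1r.
  have -> : \prod_m chi (z.2 0 m * z.1 0 m) = chi (dotv z.1 z.2).
    rewrite /dotv (big_morph chi chiD chi0).
    by apply: eq_bigr => m _; rewrite mulrC.
  have -> : dotv (- z).1 (- z).2 = dotv z.1 z.2.
    by apply: eq_bigr => m _; rewrite !mxE mulrNN.
  have half2 : 2%:R^-1 + 2%:R^-1 = 1 :> 'F_d.
    rewrite -mulr2n -[LHS]mulr_natl divff//.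
    by rewrite -(dvdn_pcharf (pchar_Fp d_prime)) gtnNdvd.
  by rewrite mulrCA -chiD -opprD -mulrDl half2 mul1r addNr chi0 mulr1.
rewrite mul0r; apply/eqP; rewrite mulf_eq0; apply/orP; right.
have /existsP[m zm] : [exists m, (z.1 0 m != z'.1 0 m) || (z.2 0 m != z'.2 0 m)].
  apply: contraNT zz' => /existsPn h; case: z z' h => p q [p' q'] /= h.
  by apply/eqP; congr (_, _); apply/rowP => m; have := h m;
    rewrite negb_or !negbK => /andP[/eqP ? /eqP ?].
rewrite (bigD1 m)//= mulf_eq0; apply/orP; left.
by case/orP: zm => /negPf ->; rewrite !mul0r ?mulr0.
Qed.

Lemma char_fun_mean_state (rho : operator R d n) (z : V) :
  char_fun (mean_state rho) z =
    if z \in skeleton rho then char_fun rho z else 0.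
Proof.
rewrite {1}/char_fun /mean_state -scalemxAl mulmx_suml mxtraceZ raddf_sum /=.
under eq_bigr => u _ do
  rewrite -scalemxAl mxtraceZ tr_weyl_mul mulrCA.
have dn0 : d%:R ^+ n != 0 :> C.
  by rewrite expf_neq0// pnatr_eq0 -lt0n prime_gt0.
case: ifPn => [zS|zNS].
  rewrite (bigD1 z)//= big1 => [|u /andP[_ /negPf->]]; last by rewrite mul0r.
  by rewrite eqxx mul1r addr0 mulrCA mulVf// mulr1.
rewrite big1 ?mulr0// => u uS; case: eqVneq => [uz|]; last by rewrite mul0r.
by rewrite uz (negPf zNS) in uS.
Qed.

End WeylOrthogonality.

Section Entropy.
Context {R : realType} {m : nat}.
Local Notation C := R[i].
Implicit Types rho tau : 'M[C]_m.

Definition is_state rho : Prop :=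
  [/\ rho \is hermsymmx,
      forall v : 'cV[C]_m, 0 <= (v^t* *m rho *m v) 0 0
    & \tr rho = 1].

Definition log2 (x : R) : R := ln x / ln 2.

(* Logarithm of a positive semidefinite matrix by spectral calculus. Since
   [ln 0 = 0], it vanishes on the kernel (convention 0 log 0 = 0). *)
Definition log2mx rho : 'M[C]_m :=
  invmx (spectralmx rho)
    *m diag_mx (map_mx (fun x => (log2 (complex.Re x))%:C) (spectral_diag rho))
    *m spectralmx rho.

Definition vn_entropy rho : R := complex.Re (- \tr (rho *m log2mx rho)).

(* The support of a Hermitian operator is its range, i.e. its column space,
   whereas [<=%MS] compares row spaces. *)
Definition supp_le rho tau : bool := (rho^T <= tau^T)%MS.

(* Equal to +oo when the support condition fails, so that an identity
   [rel_entropy rho tau = x%:E] includes the support inclusion. *)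
Definition rel_entropy rho tau : \bar R :=
  if supp_le rho tau
  then (complex.Re (\tr (rho *m (log2mx rho - log2mx tau))))%:E
  else +oo%E.

End Entropy.

(* Main.v *)
Require Import Defs.
From HB Require Import structures.
From mathcomp Require Import all_boot all_order all_algebra.
From mathcomp Require Import spectral sesquilinear.
From mathcomp Require Import complex ring.
From mathcomp Require Import all_classical all_reals all_analysis.
From mathcomp Require finfield.

(* Each [rho_k] is a twirl of [sigma] over the group [w(N_k)], and twirling over
   [N_(k+1)] absorbs twirling over [N_k]. Since [log rho_(k+1)] commutes with
   [w(N_(k+1))], [tr rho_k log rho_(k+1) = tr rho_(k+1) log rho_(k+1)], so that
   [D(rho_k || rho_(k+1)) = S(rho_(k+1)) - S(rho_k)]. A Weyl operator with
   [|tr (sigma w)| = 1] acts on [sigma] as a phase; hence [rho_r = sigma], [M(sigma)]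
   is a multiple of a projector that fixes every [rho_k], and
   [tr rho_k log M(sigma) = tr M(sigma) log M(sigma)] as well. Monotonicity of the
   entropy is then Klein's inequality.
   The bound [log d] follows from [rho_k <= d rho_(k+1)] without operator
   monotonicity of the logarithm: in eigenbases [e_i], [f_j] of [rho], [tau] with
   eigenvalues [p_i], [q_j] and overlaps [a_ji = |<f_j, e_i>|^2], testing
   [c tau - rho >= 0] on [tau^-1 e_i] gives [p_i \sum_j a_ji / q_j <= c], and
   [ln x <= x - 1] turns this into [D(rho || tau) <= log c]. *)

Set Implicit Arguments.
Unset Strict Implicit.
Unset Printing Implicit Defensive.

Import Order.TTheory GRing.Theory Num.Theory.
Local Open Scope ring_scope.

Lemma mxtrace_mulmxBr (F : pzRingType) m (A B B' : 'M[F]_m) :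
  \tr (A *m (B - B')) = \tr (A *m B) - \tr (A *m B').
Proof. by rewrite mulmxBr raddfB. Qed.

(** * Functional calculus of diagonalized matrices *)

Section DiagonalCalculus.
Context {F : fieldType} {m : nat} (P Q : 'M[F]_m).
Hypotheses (PQ : P *m Q = 1%:M) (QP : Q *m P = 1%:M).
Implicit Types (A B U : 'M[F]_m) (D : 'rV[F]_m).

Lemma simmxM A B : (Q *m A *m P) *m (Q *m B *m P) = Q *m (A *m B) *m P.
Proof. by rewrite -!mulmxA (mulmxA P Q) PQ mul1mx. Qed.

Lemma simmxK A : P *m (Q *m A *m P) *m Q = A.
Proof. by rewrite !mulmxA PQ mul1mx -mulmxA PQ mulmx1. Qed.

Lemma simmxKV A : Q *m (P *m A *m Q) *m P = A.
Proof. by rewrite !mulmxA QP mul1mx -mulmxA QP mulmx1. Qed.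

(** In the eigenbasis, commutation says that an entry of [V] vanishes unless it couples two equal
    eigenvalues. Equal eigenvalues stay equal under [f]. *)
Lemma diag_calculus_comm (f : F -> F) D U :
  (Q *m diag_mx D *m P) *m U = U *m (Q *m diag_mx D *m P) ->
  (Q *m diag_mx (map_mx f D) *m P) *m U = U *m (Q *m diag_mx (map_mx f D) *m P).
Proof.
rewrite -(simmxKV U) !simmxM; move: (_ *m Q) => V.
move/(congr1 (fun X => P *m X *m Q)); rewrite !simmxK => DV.
congr (_ *m _ *m _); apply/matrixP => i j; have /matrixP/(_ i j) := DV.
rewrite !mul_diag_mx !mul_mx_diag !mxE mulrC => /eqP.
rewrite -subr_eq0 -mulrBr mulf_eq0 subr_eq0 => /orP[/eqP->|/eqP->].
  by rewrite mul0r mulr0.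
by rewrite mulrC.
Qed.

(** The quadratic relation leaves only the eigenvalues 0 and [a], and at both of them [f] agrees
    with multiplication by [b]. *)
Lemma diag_calculus_quasi_idem (f : F -> F) (a b : F) D : f 0 = 0 -> f a = b * a ->
  (Q *m diag_mx D *m P) *m (Q *m diag_mx D *m P) = a *: (Q *m diag_mx D *m P) ->
  Q *m diag_mx (map_mx f D) *m P = b *: (Q *m diag_mx D *m P).
Proof.
move=> f0 fa; rewrite simmxM ![_ *: (_ *m _ *m _)]scalemxAl.
rewrite ![_ *: (_ *m _)]scalemxAr.
move/(congr1 (fun X => P *m X *m Q)); rewrite !simmxK => DD.
congr (_ *m _ *m _); apply/matrixP => i j; have /matrixP/(_ i i) := DD.
rewrite mul_diag_mx !mxE eqxx mulr1n => /eqP.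
rewrite -subr_eq0 -mulrBl mulf_eq0 subr_eq0 => /orP[] /eqP ->.
  by rewrite fa mulrnAr.
by rewrite f0 !mul0rn mulr0.
Qed.

End DiagonalCalculus.

(** * Positive semidefinite matrices *)

Section PositiveMatrices.
Local Open Scope sesquilinear_scope.
Context {C : numClosedFieldType}.

Lemma adjmxM k l s (A : 'M[C]_(k, l)) (B : 'M[C]_(l, s)) :
  (A *m B)^t* = B^t* *m A^t*.
Proof. by rewrite trmx_mul map_mxM. Qed.

Lemma tr_adjM k l (B : 'M[C]_(k, l)) :
  \tr (B *m B^t*) = \sum_i \sum_j `|B i j| ^+ 2.
Proof.
apply: eq_bigr => i _; rewrite mxE; apply: eq_bigr => j _.
by rewrite !mxE normCK.
Qed.

Lemma tr_adjM_eq0 k l (B : 'M[C]_(k, l)) : \tr (B *m B^t*) = 0 -> B = 0.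
Proof.
have B2_ge0 i j : 0 <= `|B i j| ^+ 2 by rewrite exprn_ge0.
rewrite tr_adjM => /eqP; rewrite psumr_eq0 => [/allP B0|i _]; last exact: sumr_ge0.
apply/matrixP => i j; rewrite mxE; have := B0 i (mem_index_enum _).
rewrite psumr_eq0 // => /allP /(_ j (mem_index_enum _)).
by rewrite expf_eq0 /= normr_eq0 => /eqP.
Qed.

Context {m : nat}.
Implicit Types (A B U : 'M[C]_m) (D E : 'rV[C]_m).

Lemma adjmxZ a A : (a *: A)^t* = a^* *: A^t*.
Proof. by apply/matrixP => i j; rewrite !mxE rmorphM. Qed.

Lemma adjmx_sum (I : finType) (P : pred I) (F : I -> 'M[C]_m) :
  (\sum_(i | P i) F i)^t* = \sum_(i | P i) (F i)^t*.
Proof.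
apply/matrixP => i j; rewrite !mxE !summxE rmorph_sum /=.
by apply: eq_bigr => k _; rewrite !mxE.
Qed.

Lemma unitarymx_adjM U : U \is unitarymx -> U^t* *m U = 1%:M.
Proof. by move/unitarymxP/mulmx1C. Qed.

Lemma mxtrace_adj A : \tr (A^t*) = (\tr A)^*.
Proof. by rewrite trace_map_mx mxtrace_tr. Qed.

Definition psdmx A :=
  A^t* = A /\ forall v : 'cV[C]_m, 0 <= (v^t* *m A *m v) 0 0.

Lemma psdmx_hermsymmx A : psdmx A -> A \is hermsymmx.
Proof. by case=> Ah _; apply/is_hermitianmxP; rewrite expr0 scale1r Ah. Qed.

Lemma psdmx_sum (I : finType) (P : pred I) (F : I -> 'M[C]_m) :
  (forall i, P i -> psdmx (F i)) -> psdmx (\sum_(i | P i) F i).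
Proof.
move=> FP; split=> [|v].
  by rewrite adjmx_sum; apply: eq_bigr => i /FP[].
rewrite mulmx_sumr mulmx_suml summxE; apply: sumr_ge0 => i /FP[_]; exact.
Qed.

Lemma psdmxZ (a : C) A : 0 <= a -> psdmx A -> psdmx (a *: A).
Proof.
move=> a0 [Ah Ap]; split=> [|v].
  by rewrite adjmxZ Ah; congr (_ *: _); apply/CrealP/ger0_real.
by rewrite -scalemxAr -scalemxAl mxE mulr_ge0.
Qed.

Lemma psdmx_conj A U : psdmx A -> psdmx (U *m A *m U^t*).
Proof.
case=> Ah Ap; split=> [|v]; first by rewrite !adjmxM trmxCK Ah mulmxA.
by have := Ap (U^t* *m v); rewrite adjmxM trmxCK !mulmxA.
Qed.

Lemma psdmx_gram U : psdmx (U *m U^t*).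
Proof.
split=> [|v]; first by rewrite adjmxM trmxCK.
rewrite -mulmxA -mulmxA mulmxA -{1}(trmxCK U) -adjmxM.
rewrite mxE; apply: sumr_ge0 => i _; rewrite !mxE.
by rewrite -normCKC exprn_ge0.
Qed.

Lemma spectral_decomp A : psdmx A ->
  A = (spectralmx A)^t* *m diag_mx (spectral_diag A) *m spectralmx A.
Proof.
move=> /psdmx_hermsymmx/hermitian_normalmx/orthomx_spectralP.
by rewrite invmx_unitary ?spectral_unitarymx.
Qed.

Lemma spectral_diag_ge0 A i : psdmx A -> 0 <= spectral_diag A 0 i.
Proof.
move=> Apsd; have := spectral_decomp Apsd; have PU := spectral_unitarymx A.
move: (spectralmx A) (spectral_diag A) PU Apsd => P D /unitarymxP PP Apsd defA.
(* The quadratic form at the i-th eigenvector is the i-th eigenvalue. *)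
have [_ /(_ (P^t* *m delta_mx i 0))] := Apsd.
rewrite adjmxM trmxCK defA; move: (P^t*) PP => Q PP.
rewrite !mulmxA -[_ *m _ *m Q]mulmxA PP mulmx1.
rewrite -[_ *m _ *m Q]mulmxA PP mulmx1.
have -> : (delta_mx i 0 : 'cV[C]_m)^t* = delta_mx 0 i :> 'rV_m.
  by apply/matrixP => k l; rewrite !mxE andbC conjC_nat.
by rewrite -rowE -colE !mxE eqxx mulr1n.
Qed.

Lemma psdmx_sqrt A : psdmx A -> exists B, A = B^t* *m B.
Proof.
move=> Apsd; have := spectral_decomp Apsd.
move: (spectralmx A) (spectral_diag A) (fun i => spectral_diag_ge0 i Apsd) => P D D0 ->.
exists (diag_mx (\row_i sqrtC (D 0 i)) *m P).
rewrite adjmxM mulmxA -[_ *m _ *m diag_mx _]mulmxA; congr (_ *m _ *m _).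
apply/matrixP => i j; rewrite mul_mx_diag !mxE eq_sym.
case: eqVneq => [->|_]; last by rewrite !mulr0n conjC0 mul0r.
by rewrite !mulr1n (CrealP _) ?ger0_real ?sqrtC_ge0// -expr2 sqrtCK.
Qed.

(** With [A = B^t* *m B], the trace is the squared Hilbert-Schmidt norm of [U *m B^t*]. *)
Lemma psdmx_conj_tr0 A U : psdmx A -> \tr (U *m A *m U^t*) = 0 -> U *m A = 0.
Proof.
case/psdmx_sqrt => B -> tr0.
have /tr_adjM_eq0 UB0 : \tr ((U *m B^t*) *m (U *m B^t*)^t*) = 0.
  by rewrite adjmxM trmxCK -tr0 !mulmxA.
by rewrite mulmxA UB0 mul0mx.
Qed.

Lemma psdmx_tr_ge0 A : psdmx A -> 0 <= \tr A.
Proof.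
case/psdmx_sqrt => B ->; rewrite -{2}(trmxCK B) tr_adjM.
by do 2!apply: sumr_ge0 => ? _; rewrite exprn_ge0.
Qed.

(** Take [U] spanning the left kernel of [B]. Conjugating [c *: B - A] by [U] leaves the conjugate
    of [- A], so the trace of the conjugate of [A] is both nonnegative and nonpositive. Hence [U]
    kills [A] as well. *)
Lemma psdmx_dominated_submx (c : C) A B :
  psdmx A -> psdmx (c *: B - A) -> (A^T <= B^T)%MS.
Proof.
move=> Apsd BApsd; rewrite submxE; set K := cokermx _.
have K0 : B^T *m K = 0 by rewrite mulmx_coker.
pose U := K^T; have UB : U *m B = 0.
  by rewrite /U -[B]trmxK -trmx_mul K0 trmx0.
have Uh X : psdmx X -> 0 <= \tr (U *m X *m U^t*).
  by move=> Xpsd; apply/psdmx_tr_ge0/psdmx_conj.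
have UA : U *m A = 0.
  apply: (psdmx_conj_tr0 Apsd); apply/eqP; rewrite eq_le Uh// andbT.
  have := Uh _ BApsd; rewrite mulmxBr -scalemxAr UB scaler0 sub0r.
  by rewrite mulNmx raddfN /= oppr_ge0.
by rewrite -[K]trmxK -trmx_mul -/U UA trmx0.
Qed.

Lemma trmx_submxP A B : reflect (exists X, A = B *m X) (A^T <= B^T)%MS.
Proof.
apply: (iffP submxP) => [[X AX]|[X ->]]; exists X^T; last by rewrite trmx_mul.
by rewrite -[A]trmxK AX trmx_mul trmxK.
Qed.

(** * Overlaps of two orthonormal eigenbases *)

Section Overlap.
Context (P Q : 'M[C]_m) (PU : P \is unitarymx) (QU : Q \is unitarymx).

(** The columns of [P^t*] and [Q^t*] are the eigenvectors e_i and f_j, so this is the transition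
    probability between them. Unitarity of [Q *m P^t*] makes the array doubly stochastic. *)
Definition overlap j i := `|(Q *m P^t*) j i| ^+ 2.

Lemma overlap_ge0 j i : 0 <= overlap j i.
Proof. by rewrite exprn_ge0. Qed.

Let WU : Q *m P^t* \is unitarymx.
Proof. by rewrite mul_unitarymx// trmxC_unitary. Qed.

Lemma overlap_row j : \sum_i overlap j i = 1.
Proof.
have /unitarymxP/matrixP/(_ j j) := WU; rewrite [in RHS]mxE eqxx mulr1n => <-.
by rewrite mxE; apply: eq_bigr => i _; rewrite /overlap normCK !mxE.
Qed.

Lemma overlap_col i : \sum_j overlap j i = 1.
Proof.
have /unitarymx_adjM/matrixP/(_ i i) := WU; rewrite [in RHS]mxE eqxx mulr1n => <-.
by rewrite mxE; apply: eq_bigr => j _; rewrite /overlap normCKC !mxE.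
Qed.

Lemma overlap_real j i : overlap j i \is Num.real.
Proof. by rewrite ger0_real// overlap_ge0. Qed.

Lemma tr_overlap D E :
  \tr ((P^t* *m diag_mx D *m P) *m (Q^t* *m diag_mx E *m Q)) =
  \sum_i \sum_j D 0 i * overlap j i * E 0 j.
Proof.
rewrite -!mulmxA mxtrace_mulC.
have -> : (diag_mx D *m (P *m (Q^t* *m (diag_mx E *m Q)))) *m P^t* =
    diag_mx D *m ((Q *m P^t*)^t* *m (diag_mx E *m (Q *m P^t*))).
  by rewrite adjmxM trmxCK !mulmxA.
apply: eq_bigr => i _; rewrite [diag_mx D *m _]mul_diag_mx 2!mxE mulr_sumr.
apply: eq_bigr => j _; rewrite mul_diag_mx [in LHS]mxE -mulrA; congr (_ * _).
by rewrite /overlap normCKC !mxE -!mulrA; congr (_ * _); rewrite mulrC.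
Qed.

(** Range inclusion factors the first matrix through the second. In the two eigenbases the
    factorization has [diag_mx E] on the left, so its row [j] vanishes with [E 0 j]. *)
Lemma overlap_supp D E i j :
  ((P^t* *m diag_mx D *m P)^T <= (Q^t* *m diag_mx E *m Q)^T)%MS ->
  E 0 j = 0 -> overlap j i * D 0 i = 0.
Proof.
case/trmx_submxP => X AX Ej.
have : Q *m P^t* *m diag_mx D = diag_mx E *m (Q *m X *m P^t*).
  have := congr1 (fun Y => Q *m Y *m P^t*) AX.
  rewrite !mulmxA (unitarymxP QU) mul1mx => <-.
  by rewrite -[_ *m P *m _]mulmxA (unitarymxP PU) mulmx1.
move/matrixP/(_ j i); rewrite mul_mx_diag mul_diag_mx [LHS]mxE [RHS]mxE Ej mul0r => /eqP.
by rewrite mulf_eq0 /overlap => /orP[]/eqP->; rewrite ?normr0 ?expr0n ?mul0r ?mulr0.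
Qed.

(** The test vector is the pseudo-inverse of the dominating matrix applied to e_i: since 1/0 = 0,
    its components in the kernel are dropped. Both the form of the dominating matrix at this vector
    and its coefficient along e_i equal the sum [s]. Keeping only the i-th term of the other form
    gives [D 0 i * s ^+ 2 <= c * s]. *)
Lemma overlap_dominated (c : C) D E i :
  (forall k, 0 <= D 0 k) -> (forall k, 0 <= E 0 k) -> 0 <= c ->
  psdmx (c *: (Q^t* *m diag_mx E *m Q) - P^t* *m diag_mx D *m P) ->
  D 0 i * \sum_j overlap j i / E 0 j <= c.
Proof.
move=> D0 E0 c0 [_ /(_ (Q^t* *m \col_j ((Q *m P^t*) j i / E 0 j)))].
set s := \sum_j _; set v := \col_j _.
have s0 : 0 <= s by apply: sumr_ge0 => j _; rewrite divr_ge0 ?overlap_ge0.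
have vE j : v j 0 = (Q *m P^t*) j i / E 0 j by rewrite mxE.
rewrite mulmxBr mulmxBl mxE [X in _ + X]mxE -scalemxAr -scalemxAl mxE subr_ge0.
have -> : ((Q^t* *m v)^t* *m (Q^t* *m diag_mx E *m Q) *m (Q^t* *m v)) 0 0 = s.
  have -> : (Q^t* *m v)^t* *m (Q^t* *m diag_mx E *m Q) *m (Q^t* *m v) =
      v^t* *m (diag_mx E *m v).
    rewrite adjmxM trmxCK !mulmxA -[_ *m Q *m _]mulmxA (unitarymxP QU) mulmx1.
    by rewrite -[_ *m Q *m _]mulmxA (unitarymxP QU) mulmx1.
  rewrite mxE; apply: eq_bigr => j _.
  have -> : (diag_mx E *m v) j 0 = E 0 j * v j 0 by rewrite mul_diag_mx mxE.
  have -> : (v^t*) 0 j = (v j 0)^* by rewrite 2!mxE.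
  rewrite vE /overlap; move: ((Q *m P^t*) j i) => w.
  have [->|Ej] := eqVneq (E 0 j) 0; first by rewrite invr0 !mulr0.
  rewrite rmorphM fmorphV [E 0 j * _]mulrC divfK// normCKC.
  by rewrite /= (conj_Creal (ger0_real (E0 j))) mulrAC.
set u := P *m (Q^t* *m v).
have -> : ((Q^t* *m v)^t* *m (P^t* *m diag_mx D *m P) *m (Q^t* *m v)) 0 0 =
    \sum_k D 0 k * `|u k 0| ^+ 2.
  have -> : (Q^t* *m v)^t* *m (P^t* *m diag_mx D *m P) *m (Q^t* *m v) =
      u^t* *m (diag_mx D *m u) by rewrite /u [(P *m _)^t*]adjmxM !mulmxA.
  rewrite mxE; apply: eq_bigr => k _; rewrite mul_diag_mx !mxE normCKC.
  by rewrite mulrCA.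
have us : u i 0 = s.
  rewrite /u mulmxA -{1}(trmxCK P) -adjmxM mxE; apply: eq_bigr => j _.
  by rewrite mxE mxE vE /overlap normCKC mulrA.
move=> us_le.
have : D 0 i * s ^+ 2 <= c * s.
  apply: le_trans us_le; rewrite (bigD1 i)//= us ger0_norm// lerDl.
  by apply: sumr_ge0 => k _; rewrite mulr_ge0 ?exprn_ge0.
have [->|sN0] := eqVneq s 0; first by rewrite !mulr0.
by rewrite expr2 mulrA ler_pM2r// lt0r sN0.
Qed.

End Overlap.

Lemma overlap_id P i j : P \is unitarymx -> overlap P P j i = (j == i)%:R.
Proof.
by move=> PU; rewrite /overlap (unitarymxP PU) mxE -normrX -natrX normr_nat; case: eqP.
Qed.

Lemma tr_spectral_diag A : psdmx A -> \tr A = \sum_i spectral_diag A 0 i.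
Proof.
move=> Apsd; rewrite {1}(spectral_decomp Apsd) mxtrace_mulC mulmxA.
by rewrite (unitarymxP (spectral_unitarymx A)) mul1mx mxtrace_diag.
Qed.
End PositiveMatrices.

(** * Classical entropy inequalities for doubly stochastic overlaps *)

Section Gibbs.
Context {R : realType}.
Implicit Types x y c : R.

Let ln2_gt0 : 0 < ln 2 :> R.
Proof. by rewrite ln_gt0// ltr1n. Qed.

(** This is ln t <= t - 1 at t = x / y, the analytic source of both inequalities below. *)
Lemma log2B_le x y : 0 < x -> 0 < y -> log2 x - log2 y <= (x / y - 1) / ln 2.
Proof.
move=> x0 y0; rewrite /log2 -mulrBl ler_pM2r ?invr_gt0// -ln_div ?posrE//.
have := @le_ln1Dx R (x / y - 1); rewrite [1 + _]addrC subrK; apply.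
by rewrite ltrBrDr addNr divr_gt0.
Qed.

Context {m : nat} (p q : 'I_m -> R) (a : 'I_m -> 'I_m -> R).
Hypotheses (p_ge0 : forall i, 0 <= p i) (q_ge0 : forall j, 0 <= q j).
Hypotheses (a_ge0 : forall j i, 0 <= a j i).
Hypotheses (a_col : forall i, \sum_j a j i = 1).
Hypothesis (a_supp : forall i j, q j = 0 -> a j i * p i = 0).

(** Each difference of terms is at most a_ji (q_j - p_i) / ln 2, and row and column sums 1 make
    these bounds add up to zero. Where q_j = 0, the support hypothesis removes the term, so the
    convention ln 0 = 0 does no harm. *)
Lemma gibbs : (forall j, \sum_i a j i = 1) -> \sum_i p i = \sum_j q j ->
  \sum_i \sum_j p i * a j i * log2 (q j) <= \sum_i \sum_j p i * a j i * log2 (p i).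
Proof.
move=> a_row pq; rewrite -subr_le0 -sumrB.
apply: (@le_trans _ _ (\sum_i \sum_j (a j i * (q j - p i)) / ln 2)).
  apply: ler_sum => i _; rewrite -sumrB; apply: ler_sum => j _.
  rewrite -mulrBr [p i * _]mulrC.
  have [qj0|qj0] := eqVneq (q j) 0.
    by rewrite a_supp// mul0r qj0 sub0r mulrN a_supp// oppr0 mul0r.
  have [pi0|pi0] := eqVneq (p i) 0.
    by rewrite pi0 mulr0 mul0r subr0 !mulr_ge0// invr_ge0 ltW.
  rewrite -!mulrA ler_wpM2l//.
  have := log2B_le (x := q j) (y := p i).
  rewrite !lt0r pi0 qj0 p_ge0 q_ge0 => /(_ isT isT) /(ler_wpM2l (p_ge0 i)).
  suff -> : p i * ((q j / p i - 1) / ln 2) = (q j - p i) / ln 2 by [].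
  by field; rewrite pi0 gt_eqF.
under eq_bigr do rewrite -mulr_suml; rewrite -mulr_suml.
rewrite pmulr_lle0 ?invr_gt0//.
have -> : \sum_i \sum_j a j i * (q j - p i) =
    \sum_j \sum_i a j i * q j - \sum_i \sum_j a j i * p i.
  rewrite [X in X - _]exchange_big -sumrB; apply: eq_bigr => i _; rewrite -sumrB.
  by apply: eq_bigr => j _; rewrite mulrBr.
under eq_bigr do rewrite -mulr_suml a_row mul1r.
by under [X in _ - X]eq_bigr do rewrite -mulr_suml a_col mul1r; rewrite pq subrr.
Qed.

(** The logarithmic bound is applied to p_i against c q_j. Summed over j with weights p_i a_ji, its
    right side is p_i (p_i \sum_j a_ji / q_j / c - 1) / ln 2, which the hypothesis makes
    nonpositive. *)
Lemma gibbs_rev c : 0 < c -> \sum_i p i = 1 ->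
  (forall i, p i * \sum_j a j i / q j <= c) ->
  \sum_i \sum_j p i * a j i * log2 (p i) - \sum_i \sum_j p i * a j i * log2 (q j)
    <= log2 c.
Proof.
move=> c0 p1 pac; rewrite -sumrB.
apply: (@le_trans _ _ (\sum_i \sum_j (p i * a j i * log2 c +
   (p i * ((p i * (a j i / q j)) / c) - p i * a j i) / ln 2))).
  apply: ler_sum => i _; rewrite -sumrB; apply: ler_sum => j _.
  rewrite -mulrBr.
  have [qj0|qj0] := eqVneq (q j) 0.
    rewrite [p i * a j i]mulrC a_supp// qj0 invr0 !mulr0.
    by rewrite !(mul0r, mulr0, subr0, addr0).
  have [->|pi0] := eqVneq (p i) 0; first by rewrite !(mul0r, mulr0, addr0, subr0).
  have pgt : 0 < p i by rewrite lt0r pi0 p_ge0.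
  have qgt : 0 < q j by rewrite lt0r qj0 q_ge0.
  rewrite -lerBlDl -mulrBr.
  have -> : (p i * (p i * (a j i / q j) / c) - p i * a j i) / ln 2
    = p i * a j i * ((p i / (c * q j) - 1) / ln 2).
    by field; rewrite !gt_eqF.
  rewrite ler_wpM2l ?mulr_ge0//.
  have := log2B_le pgt (mulr_gt0 c0 qgt); apply: le_trans.
  by rewrite /log2 lnM ?posrE// mulrDl opprD addrA addrAC.
have -> : \sum_i \sum_j (p i * a j i * log2 c +
      (p i * ((p i * (a j i / q j)) / c) - p i * a j i) / ln 2) =
    log2 c + (\sum_i p i * ((p i * \sum_j a j i / q j) / c) - 1) / ln 2.
  have -> : log2 c = \sum_i p i * log2 c by rewrite -mulr_suml p1 mul1r.
  rewrite -[X in _ - X]p1 -sumrB mulr_suml -big_split /=; apply: eq_bigr => i _.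
  rewrite big_split /=; congr (_ + _).
    by rewrite -mulr_suml -mulr_sumr a_col mulr1 -mulr_suml p1 mul1r.
  by rewrite -mulr_suml sumrB -!mulr_sumr a_col mulr1 -mulr_suml -mulr_sumr.
rewrite gerDl pmulr_lle0 ?invr_gt0// subr_le0 -p1; apply: ler_sum => i _.
by rewrite ler_piMr// ler_pdivrMr// mul1r pac.
Qed.

End Gibbs.

(** * Matrix logarithms and trace inequalities *)

Section Entropies.
Local Open Scope complex_scope.
Local Open Scope sesquilinear_scope.
Context {R : realType} {m : nat}.
Local Notation C := R[i].
Implicit Types (A B U : 'M[C]_m) (c : R).

Lemma is_state_psdmx A : is_state A -> psdmx A.
Proof.
by case=> /is_hermitianmxP; rewrite expr0 scale1r => Ah Ap _; split.
Qed.

Lemma log2mxE A : log2mx A =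
  (spectralmx A)^t* *m diag_mx (map_mx (fun x => (log2 (complex.Re x))%:C) (spectral_diag A))
    *m spectralmx A.
Proof. by rewrite /log2mx invmx_unitary ?spectral_unitarymx. Qed.

Lemma log2mx_comm A U : psdmx A -> A *m U = U *m A ->
  log2mx A *m U = U *m log2mx A.
Proof.
move=> Apsd; have PU := spectral_unitarymx A.
have := diag_calculus_comm (unitarymxP PU) (unitarymx_adjM PU)
  (fun x => (log2 (complex.Re x))%:C) (D := spectral_diag A) (U := U).
by rewrite -(spectral_decomp Apsd) -log2mxE.
Qed.

(** [A] is [c] times a projector. On the eigenvalues 0 and [c] the logarithm, with value 0 at 0, is
    linear of slope log c / c. *)
Lemma log2mx_quasi_idem A c : 0 < c -> psdmx A ->
  A *m A = c%:C *: A -> log2mx A = (log2 c / c)%:C *: A.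
Proof.
move=> c0 Apsd; have PU := spectral_unitarymx A.
have := diag_calculus_quasi_idem (unitarymxP PU)
  (f := fun x => (log2 (complex.Re x))%:C) (a := c%:C) (b := (log2 c / c)%:C)
  (D := spectral_diag A).
rewrite -(spectral_decomp Apsd) -log2mxE; apply.
- by rewrite /log2 ln0// mul0r.
- by rewrite /= -rmorphM /= divfK ?gt_eqF.
Qed.

(** The value does not depend on [A]. Taking for [A] a pinched state and then [B] itself equates the
    two traces against the logarithm of the mean state. *)
Lemma tr_log2mx_quasi_idem A B c : 0 < c -> psdmx B -> B *m B = c%:C *: B ->
  B *m A = c%:C *: A -> \tr A = 1 -> \tr (A *m log2mx B) = (log2 c)%:C.
Proof.
move=> c0 Bpsd BB BA trA; rewrite (log2mx_quasi_idem c0 Bpsd BB).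
transitivity (\tr ((log2 c / c)%:C *: (B *m A))).
  by rewrite mxtrace_mulC -scalemxAl.
rewrite BA !mxtraceZ trA.
by rewrite mulr1 -rmorphM /= divfK ?gt_eqF.
Qed.

(** * Reduction of a pair of positive matrices to eigenvalues and overlaps *)

Section Pair.
Context (A B : 'M[C]_m) (Apsd : psdmx A) (Bpsd : psdmx B).

Let PU := spectral_unitarymx A.
Let QU := spectral_unitarymx B.
Let p i := complex.Re (spectral_diag A 0 i).
Let q i := complex.Re (spectral_diag B 0 i).
Let a j i := complex.Re (overlap (spectralmx A) (spectralmx B) j i).

Let pE i : spectral_diag A 0 i = (p i)%:C.
Proof. by rewrite RRe_real ?ger0_real ?spectral_diag_ge0. Qed.

Let qE i : spectral_diag B 0 i = (q i)%:C.
Proof. by rewrite RRe_real ?ger0_real ?spectral_diag_ge0. Qed.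

Let aE j i : overlap (spectralmx A) (spectralmx B) j i = (a j i)%:C.
Proof. by rewrite RRe_real ?overlap_real. Qed.

Let p_ge0 i : 0 <= p i.
Proof. by rewrite -ler0c -pE spectral_diag_ge0. Qed.

Let q_ge0 i : 0 <= q i.
Proof. by rewrite -ler0c -qE spectral_diag_ge0. Qed.

Let a_ge0 j i : 0 <= a j i.
Proof. by rewrite -ler0c -aE overlap_ge0. Qed.

Let a_col i : \sum_j a j i = 1.
Proof.
apply: complexI; rewrite rmorph1 rmorph_sum -(overlap_col PU QU i).
by apply: eq_bigr => j _; rewrite /= aE.
Qed.

Let a_row j : \sum_i a j i = 1.
Proof.
apply: complexI; rewrite rmorph1 rmorph_sum -(overlap_row PU QU j).
by apply: eq_bigr => i _; rewrite /= aE.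
Qed.

Let p_sum : \tr A = 1 -> \sum_i p i = 1.
Proof.
move=> trA; apply: complexI; rewrite rmorph1 rmorph_sum -trA tr_spectral_diag//.
by apply: eq_bigr => j _; rewrite /= pE.
Qed.

Let q_sum : \tr B = 1 -> \sum_i q i = 1.
Proof.
move=> trB; apply: complexI; rewrite rmorph1 rmorph_sum -trB tr_spectral_diag//.
by apply: eq_bigr => j _; rewrite /= qE.
Qed.

Let a_supp : supp_le A B -> forall i j, q j = 0 -> a j i * p i = 0.
Proof.
move=> AB i j qj; apply: complexI; rewrite rmorphM rmorph0 /= -aE -pE.
apply: (@overlap_supp _ _ _ _ PU QU _ (spectral_diag B)); last by rewrite qE qj.
by rewrite -!spectral_decomp.
Qed.

Let tr_cross : complex.Re (\tr (A *m log2mx B)) = \sum_i \sum_j p i * a j i * log2 (q j).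
Proof.
rewrite log2mxE {1}(spectral_decomp Apsd) tr_overlap.
rewrite raddf_sum; apply: eq_bigr => i _; rewrite raddf_sum; apply: eq_bigr => j _.
by rewrite pE aE mxE -!rmorphM.
Qed.

(** The column sums 1 insert the overlaps, so that this sum runs over the same pairs as
    [tr_cross]. *)
Let tr_self : complex.Re (\tr (A *m log2mx A)) = \sum_i \sum_j p i * a j i * log2 (p i).
Proof.
rewrite log2mxE {1}(spectral_decomp Apsd) tr_overlap.
rewrite raddf_sum; apply: eq_bigr => i _; rewrite -mulr_suml -mulr_sumr a_col mulr1.
rewrite (bigD1 i)//= big1 ?addr0 => [|j ji].
  by rewrite overlap_id// eqxx mulr1 mxE pE -!rmorphM.
by rewrite overlap_id// (negPf ji) mulr0 mul0r.
Qed.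

Lemma klein : \tr A = 1 -> \tr B = 1 -> supp_le A B ->
  complex.Re (\tr (A *m log2mx B)) <= complex.Re (\tr (A *m log2mx A)).
Proof.
move=> trA trB AB; rewrite [leLHS]tr_cross [leRHS]tr_self.
exact: (gibbs p_ge0 q_ge0 a_ge0 a_col (a_supp AB) a_row
  (etrans (p_sum trA) (esym (q_sum trB)))).
Qed.

(** Domination yields both the support inclusion and, through [overlap_dominated], the bound that
    [gibbs_rev] requires. *)
Lemma klein_rev c : \tr A = 1 -> 0 < c -> psdmx (c%:C *: B - A) ->
  complex.Re (\tr (A *m log2mx A)) - complex.Re (\tr (A *m log2mx B)) <= log2 c.
Proof.
move=> trA c0 BA; have AB := a_supp (psdmx_dominated_submx Apsd BA).
suff pac i : p i * \sum_j a j i / q j <= c.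
  exact: (eq_ind_r is_true (gibbs_rev p_ge0 q_ge0 a_ge0 a_col AB c0 (p_sum trA) pac)
    (congr2 (fun x y => x - y <= log2 c) tr_self tr_cross)).
rewrite -lecR rmorphM rmorph_sum /= -pE.
have -> : \sum_j (a j i / q j)%:C =
    \sum_j overlap (spectralmx A) (spectralmx B) j i / spectral_diag B 0 j.
  by apply: eq_bigr => j _; rewrite aE qE fmorph_div.
apply: (overlap_dominated QU).
- by move=> k; exact: spectral_diag_ge0.
- by move=> k; exact: spectral_diag_ge0.
- by rewrite ler0c ltW.
- by rewrite -!spectral_decomp.
Qed.

End Pair.
End Entropies.

(** * Twirling over a finite abelian group of unitaries *)

Section Twirl.
Local Open Scope sesquilinear_scope.
Context {C : numClosedFieldType} {m : nat} {V : finZmodType}.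
Context (w : V -> 'M[C]_m).
Hypotheses (w0 : w 0 = 1%:M) (w_adj : forall u, (w u)^t* = w (- u)).
Implicit Types (N : {pred V}) (A X s : 'M[C]_m).

(** Weyl operators multiply only up to a phase in general. The phase is trivial on isotropic
    subspaces, so multiplicativity is asked only on [N]. *)
Definition hom_on N := {in N &, forall u v, w (u + v) = w u *m w v}.

Definition twirl N A := #|N|%:R^-1 *: \sum_(u in N) w u *m A *m (w u)^t*.

Section Group.
Context (N : {pred V}) (N_closed : zmod_closed N) (N_hom : hom_on N).

Let N0 : 0 \in N. Proof. by case: N_closed. Qed.

Let ND u v : v \in N -> (u + v \in N) = (u \in N).
Proof.
case: N_closed => _ NB vN; have NN : - v \in N by rewrite -sub0r NB.
apply/idP/idP => [uvN|uN]; first by rewrite -(addrK v u) NB.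
by rewrite -[v]opprK NB.
Qed.

Let NN u : u \in N -> - u \in N.
Proof. by case: N_closed => _ NB uN; rewrite -sub0r NB. Qed.

Let card_neq0 : #|N|%:R != 0 :> C.
Proof. by rewrite pnatr_eq0 -lt0n; apply/card_gt0P; exists 0. Qed.

Lemma hom_on_adjM u : u \in N -> (w u)^t* *m w u = 1%:M.
Proof. by move=> uN; rewrite w_adj -N_hom ?NN// addNr. Qed.

Lemma hom_on_Madj u : u \in N -> w u *m (w u)^t* = 1%:M.
Proof. by move=> uN; rewrite w_adj -N_hom ?NN// subrr. Qed.

Lemma hom_on_comm u v : u \in N -> v \in N -> w u *m w v = w v *m w u.
Proof. by move=> uN vN; rewrite -!N_hom// addrC. Qed.

(** Translation by [v] permutes [N]. *)
Lemma twirl_conj A v : v \in N -> twirl N (w v *m A *m (w v)^t*) = twirl N A.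
Proof.
move=> vN; congr (_ *: _); rewrite [RHS](reindex_inj (addIr v)) /=.
apply: eq_big => [u|u uN]; first by rewrite ND.
by rewrite N_hom// adjmxM !mulmxA.
Qed.

Lemma conj_twirl A v : v \in N -> w v *m twirl N A *m (w v)^t* = twirl N A.
Proof.
move=> vN; rewrite -scalemxAr -scalemxAl; congr (_ *: _).
rewrite mulmx_sumr mulmx_suml [RHS](reindex_inj (addrI v)) /=.
apply: eq_big => [u|u uN]; first by rewrite addrC ND.
by rewrite N_hom// adjmxM !mulmxA.
Qed.

Lemma twirl_comm A v : v \in N -> twirl N A *m w v = w v *m twirl N A.
Proof.
move=> vN; rewrite -{1}(conj_twirl A vN) -!mulmxA.
by rewrite hom_on_adjM// mulmx1.
Qed.

Lemma twirl_id A : {in N, forall u, w u *m A = A *m w u} -> twirl N A = A.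
Proof.
move=> AN; rewrite /twirl (eq_bigr (fun=> A)) => [|u uN]; last first.
  by rewrite AN// -mulmxA hom_on_Madj// mulmx1.
by rewrite sumr_const -scaler_nat scalerA mulVf// scale1r.
Qed.

(** By cyclicity of the trace, each conjugation moves onto [X], which it fixes. *)
Lemma tr_twirlM A X : {in N, forall u, X *m w u = w u *m X} ->
  \tr (twirl N A *m X) = \tr (A *m X).
Proof.
move=> XN; rewrite /twirl -scalemxAl mulmx_suml mxtraceZ raddf_sum /=.
rewrite (eq_bigr (fun=> \tr (A *m X))) => [|u uN]; last first.
  rewrite -!mulmxA mxtrace_mulC -!mulmxA XN//.
  by rewrite [(w u)^t* *m _]mulmxA hom_on_adjM// mul1mx.
by rewrite sumr_const -[X in _ * X]mulr_natl mulKf.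
Qed.

Lemma tr_twirl A : \tr (twirl N A) = \tr A.
Proof.
rewrite -[twirl N A]mulmx1 tr_twirlM ?mulmx1// => u _.
by rewrite mul1mx mulmx1.
Qed.

Lemma psdmx_twirl A : psdmx A -> psdmx (twirl N A).
Proof.
move=> Apsd; apply: psdmxZ; first by rewrite invr_ge0 ler0n.
by apply: psdmx_sum => u _; apply: psdmx_conj.
Qed.

Lemma twirl_twirl (N' : {pred V}) A : {subset N' <= N} -> (0 < #|N'|)%N ->
  twirl N (twirl N' A) = twirl N A.
Proof.
move=> sub N'0; have k0 : #|N'|%:R != 0 :> C by rewrite pnatr_eq0 -lt0n.
transitivity (#|N'|%:R^-1 *: \sum_(v in N') twirl N (w v *m A *m (w v)^t*)).
  rewrite /twirl -scaler_sumr [in RHS]scalerA [_^-1 * _]mulrC -[RHS]scalerA.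
  congr (_ *: _); rewrite [in RHS]exchange_big [RHS]scaler_sumr.
  apply: eq_bigr => u _; rewrite -scalemxAr -scalemxAl; congr (_ *: _).
  by rewrite mulmx_sumr mulmx_suml.
rewrite (eq_bigr (fun=> twirl N A)) => [|v vN']; last by rewrite twirl_conj ?sub.
by rewrite sumr_const -scaler_nat scalerA mulVf// scale1r.
Qed.

End Group.

(** The factor [d] turns the normalization of the larger average into that of the smaller one. What
    remains is a positive multiple of the sum of the conjugates of [A] over [N] minus [N']. *)
Lemma twirl_dominated N N' (d : nat) A : psdmx A -> {subset N' <= N} ->
  (0 < #|N'|)%N -> (0 < d)%N -> #|N| = (d * #|N'|)%N ->
  psdmx (d%:R *: twirl N A - twirl N' A).
Proof.
move=> Apsd sub N'0 d0 cardN.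
have k0 : #|N'|%:R != 0 :> C by rewrite pnatr_eq0 -lt0n.
have dN0 : d%:R != 0 :> C by rewrite pnatr_eq0 -lt0n.
rewrite /twirl cardN natrM invfM scalerA mulrA divff// mul1r -scalerBr.
apply: psdmxZ; first by rewrite invr_ge0 ler0n.
rewrite (bigID (mem N')) /=.
rewrite [X in X + _ - _](eq_bigl (mem N')) => [|u]; last first.
  by apply: andb_idl => /sub.
rewrite addrC addKr.
by apply: psdmx_sum => u _; apply: psdmx_conj.
Qed.

(* [(w u - c) s (w u - c)^t*] is positive with trace [1 - `|c| ^+ 2 = 0]. *)
Lemma stabilized_of_norm_tr s u : psdmx s -> \tr s = 1 -> w u *m w (- u) = 1%:M ->
  `|\tr (s *m w u)| = 1 -> w u *m s = \tr (s *m w u) *: s.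
Proof.
move=> spsd trs wu; set c := \tr _ => c1.
have cc : c * c^* = 1 by rewrite -normCK c1 expr1n.
have uu : (w u)^t* *m w u = 1%:M by rewrite w_adj; exact: mulmx1C.
apply/eqP; rewrite -subr_eq0 -mul_scalar_mx -mulmxBl; apply/eqP.
apply: psdmx_conj_tr0 => //.
have -> : (w u - c%:M)^t* = (w u)^t* - (c^*)%:M.
  apply/matrixP => i j; rewrite !mxE rmorphB /= eq_sym.
  by case: eqP; rewrite ?mulr1n ?mulr0n ?conjC0.
rewrite mulmxBr !mulmxBl !raddfB /= !mul_scalar_mx !mul_mx_scalar !mxtraceZ.
rewrite -scalemxAl !mxtraceZ trs mulr1.
have -> : \tr (w u *m s *m (w u)^t*) = 1.
  by rewrite mxtrace_mulC mulmxA uu mul1mx.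
have -> : \tr (w u *m s) = c by rewrite mxtrace_mulC.
have -> : \tr (s *m (w u)^t*) = c^*.
  by rewrite -mxtrace_adj adjmxM spsd.1 mxtrace_mulC.
by rewrite [c^* * c]mulrC cc; ring.
Qed.

(** * The mean state as a sum over the stabilizer group *)

Section MeanState.
Context (S : {pred V}) (S_closed : zmod_closed S) (S_hom : hom_on S).
Context (s : 'M[C]_m) (spsd : psdmx s) (trs : \tr s = 1).

Let xi u := \tr (s *m w (- u)).

Hypothesis (xi_norm : {in S, forall u, `|xi u| = 1}).

Let SB u v : u \in S -> v \in S -> u - v \in S.
Proof. by case: S_closed => _; apply. Qed.

Let SN u : u \in S -> - u \in S.
Proof. by case: S_closed => S0 _ uS; rewrite -sub0r SB. Qed.

Let xi_conj u : u \in S -> xi u * (xi u)^* = 1.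
Proof. by move=> uS; rewrite -normCK xi_norm// expr1n. Qed.

Let stab u : u \in S -> w (- u) *m s = xi u *: s.
Proof.
move=> uS; apply: stabilized_of_norm_tr => //; last exact: xi_norm.
by rewrite opprK -S_hom ?SN// addNr.
Qed.

Let stabK u : u \in S -> xi u *: (w u *m s) = s.
Proof.
move=> uS; rewrite scalemxAr -stab// mulmxA -S_hom ?SN//.
by rewrite subrr w0 mul1mx.
Qed.

(** The adjoint of [stab] shows that [w u] acts on [s] from the right by the same phase as from the
    left. *)
Lemma stabilized_comm u : u \in S -> w u *m s = s *m w u.
Proof.
move=> uS; have := congr1 (fun A => A^t*) (stab uS).
rewrite adjmxM adjmxZ spsd.1 w_adj opprK => ->.
rewrite -{2}(stabK uS) scalerA mulrC xi_conj// scale1r //.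
Qed.

(** The phases are those by which the operators [w (- u)] act on [s], so [xi] is a character of
    [S]. *)
Let xiD u v : u \in S -> v \in S -> xi (u + v) = xi u * xi v.
Proof.
move=> uS vS; rewrite {1}/xi mxtrace_mulC opprD S_hom ?SN// -mulmxA stab//.
by rewrite -scalemxAr stab// scalerA mxtraceZ trs mulr1 mulrC.
Qed.

Let xiN u : u \in S -> xi (- u) = (xi u)^*.
Proof.
by move=> uS; rewrite /xi -mxtrace_adj adjmxM spsd.1 w_adj mxtrace_mulC.
Qed.

(** This is [c * #|S|] times the projector onto the joint eigenspace where each [w (- u)] acts as
    [xi u]. The mean state is the case c = d^-n with [S] the skeleton. *)
Definition stab_sum (c : C) := c *: \sum_(u in S) xi u *: w u.

Lemma stab_sumM c : stab_sum c *m s = (c * #|S|%:R) *: s.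
Proof.
rewrite -scalemxAl mulmx_suml (eq_bigr (fun=> s)) => [|u uS].
  by rewrite sumr_const -scaler_nat scalerA.
by rewrite -scalemxAl stabK.
Qed.

(** Since [xi] is a character, multiplying by [xi u *: w u] merely translates the sum, so each
    summand of the left factor fixes the right one. *)
Lemma stab_sum_idem c : stab_sum c *m stab_sum c = (c * #|S|%:R) *: stab_sum c.
Proof.
rewrite {1}/stab_sum -scalemxAl mulmx_suml (eq_bigr (fun=> stab_sum c)) => [|u uS].
  by rewrite sumr_const -scaler_nat scalerA.
rewrite -scalemxAr mulmx_sumr; congr (_ *: _).
rewrite [RHS](reindex_inj (addrI u)) /=; apply: eq_big => [v|v vS].
  apply/idP/idP => [vS|uvS]; first by rewrite -[v]opprK SB ?SN.
  by rewrite -(addKr u v) addrC SB.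
by rewrite S_hom// xiD// -scalemxAl -scalemxAr scalerA.
Qed.

Lemma stab_sum_adj c : c \is Num.real -> (stab_sum c)^t* = stab_sum c.
Proof.
move=> cR; rewrite adjmxZ (CrealP cR) adjmx_sum; congr (_ *: _).
rewrite [RHS](reindex_inj (@oppr_inj V)) /=; apply: eq_big => [u|u uS].
  by apply/idP/idP => /SN; rewrite ?opprK.
by rewrite adjmxZ w_adj xiN.
Qed.

(** A self-adjoint X with X X = k X and k > 0 is 1/k times the Gram matrix of X. *)
Lemma psdmx_stab_sum c : 0 < c * #|S|%:R -> 0 <= c -> psdmx (stab_sum c).
Proof.
move=> cS c0; have adj := stab_sum_adj (ger0_real c0).
have -> : stab_sum c = (c * #|S|%:R)^-1 *: (stab_sum c *m (stab_sum c)^t*).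
  by rewrite adj stab_sum_idem scalerA mulVf ?gt_eqF// scale1r.
by apply: psdmxZ (psdmx_gram _); rewrite invr_ge0 ltW.
Qed.

(** The operators [w u] for [u] in [N] commute with those of [S], so the sum passes through them and
    reaches [s], where it acts as a scalar. *)
Lemma stab_sum_twirl c (N : {pred V}) : zmod_closed N -> hom_on N -> {subset S <= N} ->
  stab_sum c *m twirl N s = (c * #|S|%:R) *: twirl N s.
Proof.
move=> N_closed N_hom SsubN.
have comm v : v \in N -> stab_sum c *m w v = w v *m stab_sum c.
  move=> vN; rewrite -scalemxAl -scalemxAr mulmx_suml mulmx_sumr; congr (_ *: _).
  apply: eq_bigr => u uS; rewrite -scalemxAl -scalemxAr.
  by rewrite (hom_on_comm N_hom)// SsubN.
rewrite /twirl -scalemxAr scalerA [X in _ = X *: _]mulrC -scalerA; congr (_ *: _).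
rewrite mulmx_sumr scaler_sumr.
apply: eq_bigr => u uN; rewrite !mulmxA comm// -[_ *m _ *m s]mulmxA stab_sumM.
by rewrite -scalemxAr -scalemxAl.
Qed.

End MeanState.
End Twirl.

(** * Weyl operators as a projective representation *)

Section WeylMatrices.
Local Open Scope sesquilinear_scope.
Context {R : realType} {d n : nat}.
Hypotheses (d_prime : prime d) (d_odd : odd d).
Local Notation C := R[i].
Local Notation w := (@omega R d).
Local Notation V := (phase_vect d n).
Local Notation B := (basis_label d n).
Implicit Types (p q : 'rV['F_d]_n) (u v z : V).

Let chi (x : 'F_d) : C := w ^+ x.

Let omega_mod k : w ^+ (k %% qdim d) = w ^+ k.
Proof. by rewrite Fp_cast// expr_mod// omega_expd. Qed.

Let chiD x y : chi (x + y) = chi x * chi y.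
Proof. by rewrite /chi -exprD -[RHS]omega_mod. Qed.

Let chi0 : chi 0 = 1.
Proof. by []. Qed.

Let chi_sum (I : finType) (F : I -> 'F_d) : \prod_i chi (F i) = chi (\sum_i F i).
Proof. by rewrite (big_morph chi chiD chi0). Qed.

Let chi_conj x : (chi x)^*%R = chi (- x).
Proof.
have wn : `|w| = 1.
  have d0 : (0 < d)%N by exact: prime_gt0.
  by apply/eqP; rewrite -(@pexpr_eq1 _ _ d)// -normrX omega_expd// normr1.
have cn : chi x * (chi x)^*%R = 1 by rewrite -normCK normrX wn !expr1n.
have c0 : chi x != 0.
  by apply: contraTneq (oner_neq0 C) => c0; rewrite -cn c0 mul0r eqxx.
by apply: (mulfI c0); rewrite cn -chiD subrr.
Qed.

Let entry_conj (b : bool) x : (b%:R * chi x)^*%R = b%:R * chi (- x).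
Proof. by rewrite rmorphM /= conjC_nat chi_conj. Qed.

Let clockX (a : 'F_d) i j :
  (@clock_mx R d ^+ a) i j = (i == j)%:R * chi (a * (j : 'F_d)).
Proof.
have -> : chi (a * (j : 'F_d)) = w ^+ (a * j) by rewrite /chi -[RHS]omega_mod.
elim: (nat_of_ord a) i j => [|k IHk] i j.
  by rewrite expr0 mul0n expr0 mulr1 mxE.
rewrite exprS mxE (bigD1 i)//= big1 => [|l li]; rewrite IHk mxE; last first.
  by rewrite eq_sym (negPf li) !mul0r.
rewrite eqxx mul1r addr0 mulSn exprD.
by case: eqVneq => [->|]; rewrite ?mul1r// !mul0r mulr0.
Qed.

Let shiftX (b : 'F_d) i j :
  (@shift_mx R d ^+ b) i j = ((i : 'F_d) == (j : 'F_d) + b)%:R.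
Proof.
rewrite -{2}[b]natr_Zp; elim: (nat_of_ord b) i j => [|k IHk] i j.
  by rewrite expr0 addr0 mxE.
rewrite exprSr mxE (bigD1 ((j : 'F_d) + 1))//= big1 => [|l li].
  by rewrite IHk mxE eqxx mulr1 addr0 -addrA -natr1 [1 + _]addrC.
by rewrite !mxE (negPf li) mulr0.
Qed.

(** Basis indices are read as vectors x of F_d^n: X^q translates them by q, and Z^p multiplies by
    the character of exponent p.x. *)
Let label (i : 'I_#|{: B}|) : 'rV['F_d]_n := \row_m (enum_val i : B) m.

Let label_bij : bijective label.
Proof.
exists (fun p => enum_rank [ffun m => p 0 m]) => [i|p].
  rewrite -[RHS]enum_valK; congr enum_rank.
  by apply/ffunP => m; rewrite ffunE mxE.
by apply/rowP => m; rewrite mxE enum_rankK ffunE.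
Qed.

Let prod_eqb (p q : 'rV['F_d]_n) : \prod_m (p 0 m == q 0 m)%:R = (p == q)%:R :> C.
Proof.
have [->|pq] := eqVneq p q; first by rewrite big1// => m _; rewrite eqxx.
have /existsP[m pqm] : [exists m, p 0 m != q 0 m].
  by apply: contraNT pq => /existsPn h; apply/eqP/rowP => m; apply/eqP/negPn.
by rewrite (bigD1 m)//= (negPf pqm) mul0r.
Qed.

Let clockE p i j : @clock R d n p i j =
  (label i == label j)%:R * chi (dotv p (label j)).
Proof.
rewrite mxE (eq_bigr _ (fun m _ => clockX _ _ _)) big_split /= chi_sum -prod_eqb.
congr (_ * chi _); first by apply: eq_bigr => m _; rewrite !mxE.
by apply: eq_bigr => m _; rewrite !mxE.
Qed.

Let shiftE q i j : @Defs.shift R d n q i j = (label i == label j + q)%:R.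
Proof.
rewrite mxE (eq_bigr _ (fun m _ => shiftX _ _ _)) -prod_eqb.
by apply: eq_bigr => m _; rewrite !mxE.
Qed.

Lemma dotvDl p p' q : dotv (p + p') q = dotv p q + dotv p' q.
Proof. by rewrite -big_split; apply: eq_bigr => m _; rewrite mxE mulrDl. Qed.

Lemma dotvDr p q q' : dotv p (q + q') = dotv p q + dotv p q'.
Proof. by rewrite -big_split; apply: eq_bigr => m _; rewrite mxE mulrDr. Qed.

Lemma dotvNl p q : dotv (- p) q = - dotv p q.
Proof. by rewrite -sumrN; apply: eq_bigr => m _; rewrite mxE mulNr. Qed.

Lemma dotvNr p q : dotv p (- q) = - dotv p q.
Proof. by rewrite -sumrN; apply: eq_bigr => m _; rewrite mxE mulrN. Qed.

(** With entries in this form, identities between Weyl operators become identities between exponents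
    in ['F_d]. *)
Let weylE z i j : @weyl R d n z i j =
  (label i == label j + z.2)%:R * chi (dotv z.1 (label i) - 2%:R^-1 * dotv z.1 z.2).
Proof.
rewrite /weyl -[w ^+ _]/(chi _); set c := chi _.
rewrite mxE mxE (bigD1 i)//= big1 => [|l li].
  by rewrite clockE shiftE eqxx mul1r addr0 mulrA -chiD mulrC [- _ + _]addrC.
by rewrite clockE (inj_eq (bij_inj label_bij)) eq_sym (negPf li) !mul0r.
Qed.

Let half2 : 2%:R^-1 + 2%:R^-1 = 1 :> 'F_d.
Proof.
rewrite -mulr2n -[LHS]mulr_natl divff// -(dvdn_pcharf (pchar_Fp d_prime)).
by rewrite gtnNdvd// odd_prime_gt2.
Qed.

(** The invertibility of 2, which holds for odd [d], enters the exponent computations in this form,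
    with 2^-1 treated as an atom. *)
Let halfE x : x = 2%:R^-1 * x + 2%:R^-1 * x :> 'F_d.
Proof. by rewrite -mulrDl half2 mul1r. Qed.

(** The symmetric phase, of exponent -p.q/2, is chosen so that reordering Z^p and X^q leaves no
    residual phase. *)
Lemma weyl_adj z : (@weyl R d n z)^t* = weyl (- z).
Proof.
apply/matrixP => i j; rewrite mxE mxE !weylE entry_conj.
rewrite -subr_eq eq_sym -[(- z).1]/(- z.1) -[(- z).2]/(- z.2).
case: eqVneq => [->|]; last by rewrite !mul0r.
rewrite !mul1r !dotvNl dotvDr !dotvNr; congr chi.
move: (dotv _ z.2) (2%:R^-1) halfE => a h hE.
by rewrite [X in _ = - (_ - X) - _]hE; ring.
Qed.

(** The exponents of the two sides differ by half the symplectic form. *)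
Lemma weylD u v : sympl u v = 0 -> weyl (u + v) = @weyl R d n u *m weyl v.
Proof.
move=> /eqP; rewrite subr_eq0 => /eqP uv.
apply/matrixP => i j; rewrite [RHS]mxE.
have [unlabel labelK unlabelK] := label_bij.
rewrite (bigD1 (unlabel (label j + v.2)))//= big1 => [|l lj]; last first.
  rewrite [X in _ * X]weylE -(inj_eq (bij_inj label_bij)) unlabelK in lj *.
  by rewrite (negPf lj) mul0r mulr0.
rewrite addr0 !weylE !unlabelK eqxx mul1r.
rewrite -[(u + v).2]/(u.2 + v.2) -[(u + v).1]/(u.1 + v.1) -addrA [v.2 + u.2]addrC.
case: eqVneq => [ij|]; last by rewrite !mul0r.
rewrite !mul1r -chiD; congr chi.
have -> : label j + v.2 = label i - u.2 by rewrite ij addrA addrAC addrK.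
rewrite !dotvDl !dotvDr dotvNr uv; move: (2%:R^-1) halfE => h hE.
by rewrite [X in _ = _ + (_ - X - _)]hE; ring.
Qed.

Lemma weyl0 : @weyl R d n 0 = 1%:M.
Proof.
apply/matrixP => i j; rewrite weylE mxE addr0 (inj_eq (bij_inj label_bij)).
have -> : dotv (0 : V).1 (label i) = 0 by apply: big1 => m _; rewrite mxE mul0r.
have -> : dotv (0 : V).1 (0 : V).2 = 0 by apply: big1 => m _; rewrite mxE mul0r.
by rewrite mulr0 subr0 chi0 mulr1.
Qed.

End WeylMatrices.

(** * Relative entropy as a difference of entropies *)

Section EntropyGain.
Local Open Scope complex_scope.
Context {R : realType} {m : nat} (A B : 'M[R[i]]_m).
Hypotheses (A_state : is_state A) (B_state : is_state B).
Hypothesis AB : supp_le A B.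
Hypothesis trAB : \tr (A *m log2mx B) = \tr (B *m log2mx B).

Let ReN (x : R[i]) : complex.Re (- x) = - complex.Re x. Proof. by case: x. Qed.

Let ReB (x y : R[i]) : complex.Re (x - y) = complex.Re x - complex.Re y.
Proof. by case: x y => [? ?] []. Qed.

Let vn_entropyN (X : 'M[R[i]]_m) :
  vn_entropy X = - complex.Re (\tr (X *m log2mx X)).
Proof. exact: ReN. Qed.

Let vn_entropyB : vn_entropy B = - complex.Re (\tr (A *m log2mx B)).
Proof. exact: etrans (vn_entropyN B) (congr1 (fun x => - complex.Re x) (esym trAB)). Qed.

(** By [trAB], the cross term of the relative entropy is minus the entropy of [B]. The hypotheses
    fit both consecutive pinchings and a pinching paired with the mean state. *)
Lemma rel_entropy_gain : rel_entropy A B = (vn_entropy B - vn_entropy A)%:E.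
Proof.
rewrite /rel_entropy AB vn_entropyB (vn_entropyN A); congr _%:E.
apply: etrans (congr1 _ (mxtrace_mulmxBr A _ _)) _; apply: etrans (ReB _ _) _.
by rewrite opprK addrC.
Qed.

Lemma vn_entropy_le : vn_entropy A <= vn_entropy B.
Proof.
have [[_ _ trA] [_ _ trB]] := (A_state, B_state).
rewrite vn_entropyB (vn_entropyN A) lerN2.
exact: klein (is_state_psdmx A_state) (is_state_psdmx B_state) trA trB AB.
Qed.

Lemma vn_entropy_gain_le (c : R) : 0 < c -> psdmx (c%:C *: B - A) ->
  vn_entropy B - vn_entropy A <= log2 c.
Proof.
have [_ _ trA] := A_state => c0 BA.
rewrite vn_entropyB (vn_entropyN A) opprK addrC.
exact: klein_rev (is_state_psdmx A_state) (is_state_psdmx B_state) _ trA c0 BA.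
Qed.

End EntropyGain.

(** This makes phase space a finite abelian group, as the twirl requires. *)
HB.instance Definition _ (U V : finZmodType) := GRing.Zmodule.on (U * V)%type.

(** * Stabilizer pinchings and the mean state of a given state *)

Section Pinching.
Local Open Scope complex_scope.
Context {R : realType} {d n : nat}.
Hypotheses (d_prime : prime d) (d_odd : odd d).
Local Notation V := (phase_vect d n).
Local Notation w := (@weyl R d n).
Implicit Types (N : {vspace V}) (s : operator R d n).

Let d_gt0 : (0 < d)%N. Proof. exact: prime_gt0. Qed.

Let w0 : w 0 = 1%:M. Proof. exact: weyl0. Qed.

Let w_adj u := weyl_adj d_prime d_odd u : _ = w (- u).

Lemma card_phase_subspace N : #|N| = (d ^ \dim N)%N.
Proof. by rewrite finfield.card_vspace card_Fp. Qed.

Lemma zmod_closed_vspace N : zmod_closed (mem N).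
Proof. by split=> [|u v]; [exact: mem0v|exact: rpredB]. Qed.

Lemma isotropic_hom N : isotropic N -> hom_on w (mem N).
Proof. by move=> Niso u v uN vN; apply: weylD => //; apply: Niso. Qed.

Lemma pinching_twirl N s : pinching N s = twirl w (mem N) s.
Proof. by rewrite /twirl card_phase_subspace natrX. Qed.

Lemma mean_state_stab_sum N s : N =i skeleton s ->
  mean_state s = stab_sum w (mem N) s (d%:R ^- n).
Proof. by move=> NS; congr (_ *: _); apply: eq_bigl => z; rewrite -NS. Qed.

Lemma pinching_state N s : isotropic N -> is_state s -> is_state (pinching N s).
Proof.
move=> /isotropic_hom Nhom s_state; rewrite pinching_twirl.
have [Ah Ap] := psdmx_twirl w (mem N) (is_state_psdmx s_state).
split=> //; first exact: psdmx_hermsymmx.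
by rewrite (tr_twirl w0 w_adj (zmod_closed_vspace N) Nhom); case: s_state.
Qed.

Section Step.
Context (N N' : {vspace V}) (s : operator R d n).
Hypotheses (s_state : is_state s) (N'_iso : isotropic N').
Hypotheses (NN' : (N <= N')%VS) (dimN' : \dim N' = (\dim N).+1).

Let N_sub : {subset mem N <= mem N'}. Proof. exact/subvP. Qed.

Let N_card : (0 < #|mem N|)%N.
Proof. by rewrite card_phase_subspace expn_gt0 d_gt0. Qed.

(** One more dimension means index [d], whence the factor. This gives both the support inclusion and
    the bound log d. *)
Lemma pinching_dominated :
  psdmx (d%:R%:C *: pinching N' s - pinching N s).
Proof.
rewrite !pinching_twirl rmorph_nat; apply: twirl_dominated => //.
  exact: is_state_psdmx.
by rewrite !card_phase_subspace dimN' expnS.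
Qed.

Let N_iso : isotropic N.
Proof. by move=> u v uN vN; apply: N'_iso; apply: N_sub. Qed.

Lemma supp_le_pinching : supp_le (pinching N s) (pinching N' s).
Proof.
by apply: (psdmx_dominated_submx _ pinching_dominated); apply/is_state_psdmx/pinching_state.
Qed.

Lemma tr_pinching_log2mx :
  \tr (pinching N s *m log2mx (pinching N' s)) =
  \tr (pinching N' s *m log2mx (pinching N' s)).
Proof.
have psd' : psdmx (pinching N' s) by apply/is_state_psdmx/pinching_state.
have cl := zmod_closed_vspace N'; have hom := isotropic_hom N'_iso.
move: psd'; rewrite !pinching_twirl => psd'.
have comm : {in mem N', forall u,
    log2mx (twirl w (mem N') s) *m w u = w u *m log2mx (twirl w (mem N') s)}.
  by move=> u uN; apply: (log2mx_comm psd'); exact: (twirl_comm w0 w_adj cl hom).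
move: (log2mx _) comm => L comm.
have := tr_twirlM w0 w_adj cl hom (twirl w (mem N) s) comm.
have -> := twirl_twirl cl hom s N_sub N_card.
exact: esym.
Qed.

End Step.

Section Mean.
Context (S : {vspace V}) (s : operator R d n).
Hypotheses (s_state : is_state s) (S_iso : isotropic S) (S_skel : S =i skeleton s).

(** The nonzero eigenvalue of the mean state, that is, the inverse of the dimension of the
    stabilized subspace. *)
Let a : R := d%:R ^+ \dim S / d%:R ^+ n.

Let a_gt0 : 0 < a.
Proof. by rewrite divr_gt0// exprn_gt0// ltr0n. Qed.

Let aE : (d%:R ^- n * #|mem S|%:R) = a%:C.
Proof.
rewrite card_phase_subspace natrX mulrC /a rmorphM fmorphV !rmorphXn /=.
by rewrite rmorph_nat.
Qed.

Let s_psd := is_state_psdmx s_state.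
Let s_tr : \tr s = 1. Proof. by case: s_state. Qed.
Let S_closed := zmod_closed_vspace S.
Let S_hom := isotropic_hom S_iso.

Let xi_norm : {in mem S, forall u, `|\tr (s *m w (- u))| = 1}.
Proof.
move=> u uS; have : u \in skeleton s by rewrite -S_skel.
by rewrite inE => /eqP.
Qed.

Lemma mean_state_idem : mean_state s *m mean_state s = a%:C *: mean_state s.
Proof.
rewrite (mean_state_stab_sum S_skel) -aE.
exact: (stab_sum_idem w0 w_adj S_closed S_hom s_psd s_tr xi_norm).
Qed.

Lemma mean_state_pinching N : isotropic N -> (S <= N)%VS ->
  mean_state s *m pinching N s = a%:C *: pinching N s.
Proof.
move=> N_iso SN; rewrite pinching_twirl (mean_state_stab_sum S_skel) -aE.
apply: (stab_sum_twirl w0 w_adj S_closed S_hom s_psd s_tr xi_norm).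
- exact: zmod_closed_vspace.
- exact: isotropic_hom.
- exact/subvP.
Qed.

Lemma mean_state_state : is_state (mean_state s).
Proof.
have psdM : psdmx (mean_state s).
  rewrite (mean_state_stab_sum S_skel).
  apply: (psdmx_stab_sum w0 w_adj S_closed S_hom s_psd s_tr xi_norm).
    by rewrite aE (ltcR 0) a_gt0.
  by rewrite invr_ge0 exprn_ge0 ?ler0n.
have [_ Mp] := psdM; split=> //; first exact: psdmx_hermsymmx.
(* The trace is the characteristic function at 0, and 0 lies in the skeleton, where the mean state
   keeps the values of [s]. *)
have := char_fun_mean_state d_prime d_odd s 0.
have char0 (X : operator R d n) : char_fun X 0 = \tr X.
  by rewrite /char_fun oppr0 w0 mulmx1.
by rewrite -S_skel mem0v !char0 => ->.
Qed.

Lemma pinching_skeleton : pinching S s = s.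
Proof.
rewrite pinching_twirl; apply: (twirl_id w0 w_adj S_closed S_hom) => u uS.
exact: (stabilized_comm w0 w_adj S_closed S_hom s_psd s_tr xi_norm).
Qed.

Context (N : {vspace V}) (N_iso : isotropic N) (SN : (S <= N)%VS).

Lemma supp_le_mean_state : supp_le (pinching N s) (mean_state s).
Proof.
(* The mean state acts on the pinched state as the nonzero scalar [a], so it is undone by
   [a%:C^-1]. *)
apply/trmx_submxP; exists (a%:C^-1 *: pinching N s).
rewrite -scalemxAr mean_state_pinching// scalerA mulVf ?scale1r//.
by rewrite (inj_eq (@complexI R) a 0) gt_eqF.
Qed.

Lemma tr_mean_state_log2mx :
  \tr (pinching N s *m log2mx (mean_state s)) =
  \tr (mean_state s *m log2mx (mean_state s)).
Proof.
have [_ _ trM] := mean_state_state; have M_psd := is_state_psdmx mean_state_state.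
have [_ _ trN] := pinching_state N_iso s_state.
have idem := mean_state_idem.
exact: etrans
  (tr_log2mx_quasi_idem a_gt0 M_psd idem (mean_state_pinching N_iso SN) trN)
  (esym (tr_log2mx_quasi_idem a_gt0 M_psd idem idem trM)).
Qed.

End Mean.
End Pinching.

(** * The entropy chain along a flag *)

Theorem theorem9 (R : realType) (d n : nat)
  (d_prime : prime d) (d_odd : odd d) (n_ge1 : (1 <= n)%N)
  (sigma : operator R d n) (sigma_state : is_state sigma)
  (r : nat) (r_le_n : (r <= n)%N)
  (N : nat -> {vspace phase_vect d n})
  (N_start : N r =i skeleton sigma)
  (N_isotropic : forall k, (r <= k <= n)%N -> isotropic (N k))
  (N_dim : forall k, (r <= k <= n)%N -> \dim (N k) = k)
  (N_flag : forall k, (r <= k < n)%N -> (N k <= N k.+1)%VS) :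
  let rho k := pinching (N k) sigma in
  let M := mean_state sigma in
  [/\ [/\ vn_entropy sigma = vn_entropy (rho r),
          forall k, (r <= k < n)%N ->
            vn_entropy (rho k) <= vn_entropy (rho k.+1)
        & vn_entropy (rho n) <= vn_entropy M],
      forall k, (r <= k < n)%N ->
        rel_entropy (rho k) (rho k.+1) =
          (vn_entropy (rho k.+1) - vn_entropy (rho k))%:E /\
        rel_entropy (rho k) M =
          (rel_entropy (rho k) (rho k.+1) + rel_entropy (rho k.+1) M)%E,
      rel_entropy sigma M =
        (\sum_(r <= k < n) rel_entropy (rho k) (rho k.+1)
          + rel_entropy (rho n) M)%E
    & forall k, (r <= k < n)%N ->
        0 <= vn_entropy (rho k.+1) - vn_entropy (rho k) <= log2 d%:R].
Proof.
move=> rho M.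
have rr : (r <= r <= n)%N by rewrite leqnn.
have rho_r : rho r = sigma.
  by apply: pinching_skeleton => //; apply: N_isotropic.
have NSub k : (r <= k <= n)%N -> (N r <= N k)%VS.
  elim: k => [|k IHk] /andP[rk kn]; first by move: rk; rewrite leqn0 => /eqP->.
  move: rk; rewrite leq_eqVlt => /predU1P[->//|rk].
  by apply: subv_trans (N_flag k _); rewrite ?IHk// -ltnS rk// ltnW.
have S_iso := N_isotropic _ rr.
have rho_state k : (r <= k <= n)%N -> is_state (rho k).
  by move=> rkn; apply: pinching_state => //; apply: N_isotropic.
have M_state : is_state M by exact: (mean_state_state d_prime d_odd sigma_state S_iso N_start).
(* Every relative entropy involved is thus a finite difference of entropies, and the additivity
   claims reduce to telescoping in the reals. *)
have DM k : (r <= k <= n)%N ->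
    rel_entropy (rho k) M = (vn_entropy M - vn_entropy (rho k))%:E.
  move=> rkn; have [N_iso Nk] := (N_isotropic _ rkn, NSub _ rkn).
  apply: rel_entropy_gain.
    exact: (supp_le_mean_state d_prime d_odd sigma_state S_iso N_start N_iso Nk).
  exact: (tr_mean_state_log2mx d_prime d_odd sigma_state S_iso N_start N_iso Nk).
have step k : (r <= k < n)%N -> [/\ is_state (rho k), is_state (rho k.+1),
    supp_le (rho k) (rho k.+1),
    \tr (rho k *m log2mx (rho k.+1)) = \tr (rho k.+1 *m log2mx (rho k.+1))
  & psdmx ((real_complex R d%:R) *: rho k.+1 - rho k)].
  move=> /andP[rk kn]; have rkn : (r <= k <= n)%N by rewrite rk ltnW.
  have rkn' : (r <= k.+1 <= n)%N by rewrite leqW.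
  have NN := N_flag k; rewrite rk kn in NN; have {}NN := NN isT.
  have dimN : \dim (N k.+1) = (\dim (N k)).+1 by rewrite !N_dim.
  split; [exact: rho_state|exact: rho_state| | |].
  - by apply: supp_le_pinching => //; apply: N_isotropic.
  - by apply: tr_pinching_log2mx => //; apply: N_isotropic.
  - by apply: pinching_dominated.
have S_step k : (r <= k < n)%N -> vn_entropy (rho k) <= vn_entropy (rho k.+1).
  by case/step => *; apply: vn_entropy_le.
have D_step k : (r <= k < n)%N -> rel_entropy (rho k) (rho k.+1) =
    (vn_entropy (rho k.+1) - vn_entropy (rho k))%:E.
  by case/step => *; apply: rel_entropy_gain.
have S_last : vn_entropy (rho n) <= vn_entropy M.
  have nn : (r <= n <= n)%N by rewrite r_le_n leqnn.
  have [N_iso Nn] := (N_isotropic _ nn, NSub _ nn).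
  apply: vn_entropy_le; [exact: rho_state|exact: M_state| |].
    exact: (supp_le_mean_state d_prime d_odd sigma_state S_iso N_start N_iso Nn).
  exact: (tr_mean_state_log2mx d_prime d_odd sigma_state S_iso N_start N_iso Nn).
have S_gain k : (r <= k < n)%N ->
    vn_entropy (rho k.+1) - vn_entropy (rho k) <= log2 d%:R.
  by case/step => *; apply: vn_entropy_gain_le; rewrite ?ltr0n ?prime_gt0.
clear step rho_state M_state; clearbody rho M.
(* The case l = k + 1 is the Pythagorean identity of one step; the case k = r, l = n is the
   decomposition along the whole flag. *)
have DD k l : (r <= k <= l)%N -> (l <= n)%N ->
    rel_entropy (rho k) M = ((vn_entropy (rho l) - vn_entropy (rho k))%:E +
      rel_entropy (rho l) M)%E.
  move=> /andP[rk kl] ln; rewrite !DM ?rk ?(leq_trans kl) ?(leq_trans rk kl)//.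
  have chain (x y z : R) : z - x = (y - x) + (z - y) by ring.
  exact: congr1 (chain _ _ _).
split.
- by split; [rewrite rho_r|exact: S_step|exact: S_last].
- move=> k rkn; split; first exact: D_step.
  by have /andP[rk kn] := rkn; rewrite D_step// -DD ?rk ?leqnSn.
- rewrite -rho_r (DD r n) ?leqnn ?r_le_n// (eq_big_nat _ _ D_step) sumEFin.
  by rewrite telescope_sumr.
- by move=> k rkn; rewrite subr_ge0 S_step//= S_gain.
Qed.
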